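(* For any $x\in\mathfrak{sl}_M$ and $n\in\mathbb Z_{\ge0}$, $$\Delta x_n\,\varsigma_1(z)=D_z^{(1)}\big(-M\,x_{-1}(z)|0\rangle^{\bm k}\,\delta_{n,1}\big),$$ $$\Delta x_n\,\varsigma_2(z)=D_z^{(2)}\big(-\tfrac12M\,t_{abc}\,(x|I^a)\,I^b_{-1}(z)I^c_{-1}(z)|0\rangle^{\bm k}\,\delta_{n,1}\big).$$
   Context: Work over $\mathbb C$. Fix an integer $M\ge 3$ and let $(X|Y)=\operatorname{tr}(XY)$ on $\mathfrak{sl}_M$ (trace in the defining $M\times M$ representation). The affine algebra $\widehat{\mathfrak{sl}}_M=\mathfrak{sl}_M[t,t^{-1}]\oplus\mathbb C\mathsf k$ has $\mathsf k$ central and, with $a_n:=a\otimes t^n$, $[a_m,b_n]=[a,b]_{m+n}-n\,\delta_{m+n,0}(a|b)\mathsf k$. Fix $N\ge 1$, distinct points $z_1,\dots,z_N\in\mathbb C$, and $\bm k=(k_1,\dots,k_N)\in\mathbb C^N$ with $k_i\neq -M$ for all $i$. For $A\in\widehat{\mathfrak{sl}}_M$ let $A^{(i)}$ be its copy in the $i$-th summand of $\widehat{\mathfrak{sl}}_M^{\oplus N}$, and $\Delta A:=\sum_{i=1}^NA^{(i)}$. Let $\mathbb V_0^{\bm k}$ be the $\widehat{\mathfrak{sl}}_M^{\oplus N}$-module induced from the one-dimensional module $\mathbb C|0\rangle^{\bm k}$ over $(\mathfrak{sl}_M[t]\oplus\mathbb C\mathsf k)^{\oplus N}$ on which $\mathsf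 k^{(i)}$ acts as $k_i$ and $a_n^{(i)}$ ($n\ge0$) acts as $0$. For $A\in\widehat{\mathfrak{sl}}_M$ put $A(z):=\sum_{i=1}^N\frac{A^{(i)}}{z-z_i}$. Let $I^a=I_a$ be a basis of $\mathfrak{sl}_M$ with $(I_a|I_b)=\delta_{ab}$; repeated Lie algebra indices are summed. Let $t_{abc}:=\operatorname{tr}(I_aI_bI_c+I_bI_aI_c)$. Define $$\varsigma_1(z):=\tfrac12 I^a_{-1}(z)I^a_{-1}(z)|0\rangle^{\bm k},\qquad \varsigma_2(z):=\tfrac13t_{abc}I^a_{-1}(z)I^b_{-1}(z)I^c_{-1}(z)|0\rangle^{\bm k}.$$ Twist function: $\varphi(z):=\sum_{i=1}^N\frac{k_i}{z-z_i}$. Twisted derivative of degree $j$: $D_z^{(j)}:=\partial_z-\frac jM\varphi(z)$. *)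

(* Defs.v *)
From HB Require Import structures.
From mathcomp Require Import all_boot all_order all_algebra.
From mathcomp Require Import generic_quotient ring_quotient complex.
From mathcomp Require Import boolp classical_sets functions cardinality fsbigop.
From mathcomp Require Import reals topology normedtype derive.

Set Implicit Arguments.
Unset Strict Implicit.
Unset Printing Implicit Defensive.

Import Order.TTheory GRing.Theory Num.Theory.
Import numFieldNormedType.Exports.

Local Open Scope classical_set_scope.
Local Open Scope ring_scope.
Local Open Scope quotient_scope.

Section FinSupp.
Variables (K : pzRingType) (T : choiceType) (V : lmodType K).

Definition finsupp_pred : {pred T -> V} :=
  fun f => `[< finite_set [set t | f t <> 0] >].

Fact finsupp_submod_closed : submod_closed finsupp_pred.
Proof.
split; first by apply/asboolP; rewrite (_ : [set _ | _] = set0) // -subset0.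
move=> a f g /asboolP hf /asboolP hg; apply/asboolP.
apply: sub_finite_set (_ : finite_set ([set t | f t <> 0] `|` [set t | g t <> 0])).
  move=> t /= h; apply: contrapT => /not_orP[/= /contrapT ft /contrapT gt].
  by apply: h; rewrite /GRing.add /= /GRing.scale /= ft gt scaler0 addr0.
by rewrite finite_setU.
Qed.

HB.instance Definition _ :=
  GRing.isSubmodClosed.Build K (T -> V) finsupp_pred finsupp_submod_closed.

Record finsupp := FinSupp {
  finsupp_val :> T -> V;
  finsuppP : finsupp_val \in finsupp_pred }.

HB.instance Definition _ := [isSub for finsupp_val].
HB.instance Definition _ := [Choice of finsupp by <:].
HB.instance Definition _ := [SubChoice_isSubLmodule of finsupp by <:].

Lemma finsuppE (f : finsupp) : finite_set [set t | f t <> 0].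
Proof. by have /asboolP := finsuppP f. Qed.

Lemma finsupp0E t : (0 : finsupp) t = 0. Proof. by []. Qed.
Lemma finsuppDE (f g : finsupp) t : (f + g) t = f t + g t. Proof. by []. Qed.
Lemma finsuppNE (f : finsupp) t : (- f) t = - f t. Proof. by []. Qed.
Lemma finsuppZE a (f : finsupp) t : (a *: f) t = a *: f t. Proof. by []. Qed.

Lemma finsupp_eqP (f g : finsupp) : (forall t, f t = g t) -> f = g.
Proof. by move=> fg; apply/val_inj/funext. Qed.

Fact delta_subproof (t : T) (v : V) :
  (fun s => if s == t then v else 0) \in finsupp_pred.
Proof.
apply/asboolP; apply: sub_finite_set (finite_set1 t) => s /=.
by case: eqP.
Qed.

Definition delta (t : T) (v : V) : finsupp := FinSupp (delta_subproof t v).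

End FinSupp.
Arguments delta {K T V}.

(* For a Lie algebra (L, br), a Lie subalgebra P and a character chi of P,
   [indmod br P chi] is U(L) (x)_{U(P)} K_chi: the free vector space on the
   words in L (i.e. the tensor algebra), modulo multilinearity, the two-sided
   ideal defining U(L), and the left ideal generated by the p - chi p. *)
Section Induced.
Variables (K : fieldType) (L : lmodType K) (br : L -> L -> L).
Variables (P : set L) (chi : L -> K).

Definition words := finsupp (seq L) K^o.
Definition word (w : seq L) : words := delta w (1 : K^o).

Inductive relator : words -> Prop :=
| RelLin a x y u v : relator
    (word (u ++ (a *: x + y) :: v)
       - (a *: word (u ++ x :: v) + word (u ++ y :: v)))
| RelBr x y u v : relator
    (word (u ++ [:: x, y & v]) - word (u ++ [:: y, x & v])
       - word (u ++ br x y :: v))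
| RelChi p u : P p -> relator (word (rcons u p) - chi p *: word u).

Inductive relspan : words -> Prop :=
| RelSpan0 : relspan 0
| RelSpanD a r f : relator r -> relspan f -> relspan (a *: r + f).

Definition relmod : {pred words} := fun f => `[< relspan f >].

Fact relmod_submod_closed : submod_closed relmod.
Proof.
split; first by apply/asboolP; exact: RelSpan0.
move=> a f g /asboolP hf /asboolP hg; apply/asboolP.
elim: hf => [|b r h hr _ IH]; first by rewrite scaler0 add0r.
by rewrite scalerDr scalerA -addrA; exact: RelSpanD.
Qed.

HB.instance Definition _ :=
  GRing.isSubmodClosed.Build K words relmod relmod_submod_closed.

Definition indmod := Quotient.quot (relmod : zmodClosed words).
HB.instance Definition _ := GRing.Zmodule.on indmod.
HB.instance Definition _ := EqQuotient.on indmod.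

Definition cls (f : words) : indmod := \pi_indmod f.

Lemma cls_eqP (f g : words) : cls f = cls g <-> relspan (f - g).
Proof.
split=> [/eqP|h]; first by rewrite -[_ == _]Quotient.idealrBE => /asboolP.
by apply/eqP; rewrite -[_ == _]Quotient.idealrBE; apply/asboolP.
Qed.

Lemma clsK v : cls (repr v) = v. Proof. exact: reprK. Qed.

Lemma clsD f g : cls (f + g) = cls f + cls g.
Proof. exact: (@Quotient.pi_add _ (relmod : zmodClosed words)). Qed.

Lemma relspanZ a f : relspan f -> relspan (a *: f).
Proof.
elim=> [|b r g hr _ IH]; first by rewrite scaler0; exact: RelSpan0.
by rewrite scalerDr scalerA; exact: RelSpanD.
Qed.

Definition indmod_scale (a : K) (v : indmod) : indmod := cls (a *: repr v).

Lemma indmod_scale_cls a f : cls (a *: f) = indmod_scale a (cls f).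
Proof.
apply/cls_eqP; rewrite -scalerBr; apply: relspanZ.
by apply/cls_eqP; rewrite clsK.
Qed.

Fact indmod_scalerA a b v :
  indmod_scale a (indmod_scale b v) = indmod_scale (a * b) v.
Proof. by rewrite -[v]clsK -!indmod_scale_cls scalerA. Qed.
Fact indmod_scale1r : left_id 1 indmod_scale.
Proof. by move=> v; rewrite -[v]clsK -indmod_scale_cls scale1r. Qed.
Fact indmod_scalerDr : right_distributive indmod_scale +%R.
Proof.
by move=> a u v; rewrite -[u]clsK -[v]clsK -clsD -!indmod_scale_cls -clsD scalerDr.
Qed.
Fact indmod_scalerDl v : {morph indmod_scale^~ v : a b / a + b}.
Proof. by move=> a b; rewrite -[v]clsK -!indmod_scale_cls -clsD scalerDl. Qed.
HB.instance Definition _ := GRing.Zmodule_isLmodule.Build K indmod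
  indmod_scalerA indmod_scale1r indmod_scalerDr indmod_scalerDl.

Lemma clsZ a f : cls (a *: f) = a *: cls f.
Proof. exact: indmod_scale_cls. Qed.

Lemma cls0 : cls 0 = 0.
Proof. by rewrite -(scale0r (0 : words)) clsZ scale0r. Qed.

Definition vac : indmod := cls (word [::]).

(* x . (x1 ... xp) = (x x1 ... xp), extended linearly *)
Definition prepend_fun (x : L) (f : words) : seq L -> K^o :=
  fun w => if w is y :: s then (if y == x then f s else 0) else 0.

Fact prepend_subproof x f : prepend_fun x f \in @finsupp_pred K (seq L) K^o.
Proof.
apply/asboolP; apply: sub_finite_set (finite_image (cons x) (finsuppE f)).
by case=> [|y s] //=; case: eqP => // -> fs; exists s.
Qed.

Definition prepend x f : words := FinSupp (prepend_subproof x f).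

Definition act (x : L) (v : indmod) : indmod := cls (prepend x (repr v)).

Lemma prepend_linear x : linear (prepend x).
Proof.
move=> a f g; apply: finsupp_eqP => -[|y s].
  by rewrite finsuppDE finsuppZE /= scaler0 addr0.
rewrite finsuppDE finsuppZE /=; case: eqP => _; first by [].
by rewrite scaler0 addr0.
Qed.
HB.instance Definition _ x := GRing.isLinear.Build K words words _ (prepend x)
  (prepend_linear x).

Lemma prepend_word x w : prepend x (word w) = word (x :: w).
Proof.
apply: finsupp_eqP => -[|y s] //=; rewrite eqseq_cons.
by case: (y == x).
Qed.

Lemma relspan_prepend x f : relspan f -> relspan (prepend x f).
Proof.
elim=> [|a r {}f hr _ IH]; first by rewrite raddf0; exact: RelSpan0.
rewrite linearD linearZ /=; apply: RelSpanD => //.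
case: hr => [b y z u v|y z u v|p u Pp].
- rewrite linearB linearD linearZ /= !prepend_word -!cat_cons.
  exact: RelLin.
- by rewrite !linearB /= !prepend_word -!cat_cons; exact: RelBr.
by rewrite linearB linearZ /= !prepend_word -rcons_cons; exact: RelChi.
Qed.

Lemma act_cls x f : act x (cls f) = cls (prepend x f).
Proof.
apply/cls_eqP; rewrite -linearB; apply: relspan_prepend.
by apply/cls_eqP; rewrite clsK.
Qed.

Lemma act_linear x : linear (act x).
Proof.
move=> a u v; rewrite -[u]clsK -[v]clsK.
by rewrite -clsZ -clsD !act_cls linearP clsD clsZ.
Qed.
HB.instance Definition _ x := GRing.isLinear.Build K indmod indmod _ (act x)
  (act_linear x).

Lemma actP x a u v : act x (a *: u + v) = a *: act x u + act x v.
Proof. exact: act_linear. Qed.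

Lemma act0 x : act x 0 = 0. Proof. exact: raddf0. Qed.

Lemma words_ind (Q : words -> Prop) :
  Q 0 -> (forall a w f, Q f -> Q (a *: word w + f)) -> forall f, Q f.
Proof.
move=> Q0 QD f; have /finite_seqP[s fs] := finsuppE f.
have {fs} : forall w, f w <> 0 -> w \in s.
  by move=> w fw; have : [set` s] w by rewrite -fs.
elim: s f => [|w s IH] f hf.
  rewrite (_ : f = 0) //; apply: finsupp_eqP => w.
  by apply: contrapT => /hf.
rewrite -[f](addrNK (f w *: word w)) addrC; apply/QD/IH => t.
rewrite finsuppDE finsuppNE finsuppZE /=; case: eqP => [->|/eqP tw].
  by rewrite [f w *: 1]mulr1 subrr.
by rewrite scaler0 subr0 => /hf; rewrite inE (negPf tw).
Qed.

Lemma indmod_ind (Q : indmod -> Prop) :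
  Q vac -> (forall a u v, Q u -> Q v -> Q (a *: u + v)) ->
  (forall x v, Q v -> Q (act x v)) -> forall v, Q v.
Proof.
move=> Qv QD Qact v; rewrite -[v]clsK; elim/words_ind: (repr v) => [|a w f Qf].
  by rewrite cls0 -(addNr vac) -scaleN1r; exact: QD.
rewrite clsD clsZ; apply: QD => //; elim: w => [//|x w IH].
by rewrite -prepend_word -act_cls; exact: Qact.
Qed.

Lemma act_linearl a x y v : act (a *: x + y) v = a *: act x v + act y v.
Proof.
rewrite -[v]clsK; elim/words_ind: (repr v) => [|b w f IH].
  by rewrite cls0 !act0 scaler0 addr0.
rewrite clsD clsZ !actP IH.
rewrite (_ : act (a *: x + y) (cls (word w)) =
  a *: act x (cls (word w)) + act y (cls (word w))).
  by rewrite !scalerDr !scalerA [a * b]mulrC !addrA;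
    congr (_ + _); rewrite addrAC.
rewrite !act_cls !prepend_word -clsZ -clsD; apply/cls_eqP.
rewrite -[X in relspan X]scale1r -[X in relspan X]addr0.
apply: RelSpanD RelSpan0; exact: (RelLin a x y [::] w).
Qed.

Lemma act_br x y v : act (br x y) v = act x (act y v) - act y (act x v).
Proof.
rewrite -[v]clsK; elim/words_ind: (repr v) => [|b w f IH].
  by rewrite cls0 !act0 subrr.
rewrite clsD clsZ !actP IH.
rewrite opprD addrACA -scalerBr; congr (_ *: _ + _).
apply/eqP; rewrite eq_sym subr_eq addrC; apply/eqP.
rewrite !act_cls !prepend_word -clsD; apply/cls_eqP.
rewrite -[X in relspan X]scale1r -[X in relspan X]addr0.
apply: RelSpanD RelSpan0; rewrite opprD addrA.
exact: (RelBr x y [::] w).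
Qed.

Lemma act_vac p : P p -> act p vac = chi p *: vac.
Proof.
move=> Pp; rewrite act_cls prepend_word -clsZ; apply/cls_eqP.
rewrite -[X in relspan X]scale1r -[X in relspan X]addr0.
by apply: RelSpanD RelSpan0; exact: (RelChi [::]).
Qed.

End Induced.

Section Affine.
Variables (K : numFieldType) (M : nat).

Definition slv : {vspace 'M[K]_M} :=
  lker (linfun (mxtrace : 'M[K]_M -> K^o)).

Lemma mem_slv A : (A \in slv) = (\tr A == 0).
Proof. by rewrite memv_ker lfunE. Qed.

Definition sl := subvs_of slv.

HB.instance Definition _ := Vector.on sl.
HB.instance Definition _ := SubType.on sl.

Definition sl_br (x y : sl) : sl :=
  vsproj slv (vsval x *m vsval y - vsval y *m vsval x).

Lemma sl_brE x y :
  vsval (sl_br x y) = vsval x *m vsval y - vsval y *m vsval x.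
Proof. by rewrite vsprojK // mem_slv linearB /= mxtrace_mulC subrr. Qed.

Lemma vsval0 : vsval (0 : sl) = 0. Proof. by []. Qed.

Definition sl_form (x y : sl) : K := \tr (vsval x *m vsval y).

Lemma sl_br0r x : sl_br x 0 = 0.
Proof. by rewrite /sl_br vsval0 mulmx0 mul0mx subrr linear0. Qed.
Lemma sl_br0l x : sl_br 0 x = 0.
Proof. by rewrite /sl_br vsval0 mulmx0 mul0mx subrr linear0. Qed.

(* [finsupp int sl] is sl[t, t^-1]: f stands for \sum_n (f n) (x) t^n *)
Fact loop_br_subproof (f g : finsupp int sl) :
  (fun p => \sum_(m \in [set: int]) sl_br (f m) (g (p - m)))
    \in @finsupp_pred K int sl.
Proof.
apply/asboolP.
apply: sub_finite_set (finite_image2 +%R (finsuppE f) (finsuppE g)) => p /= h.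
apply: contrapT => hN; apply: h; apply: fsbig1 => m _.
have [->|/eqP fm] := eqVneq (f m) 0; first exact: sl_br0l.
have [->|/eqP gm] := eqVneq (g (p - m)) 0; first exact: sl_br0r.
by exfalso; apply: hN; exists m => //; exists (p - m) => //; rewrite addrC subrK.
Qed.

Definition loop_br (f g : finsupp int sl) : finsupp int sl :=
  FinSupp (loop_br_subproof f g).

(* The pair (f, c) stands for f + c k. *)
Definition affine := (finsupp int sl * K^o)%type.
HB.instance Definition _ := GRing.Lmodule.on affine.

(* On a (x) t^m and b (x) t^n the cocycle - n delta_{m+n,0} (a|b) is
   m delta_{m+n,0} (a|b); see [affine_br_mode]. *)
Definition affine_br (A B : affine) : affine :=
  (loop_br A.1 B.1,
   \sum_(m \in [set: int]) (m%:~R * sl_form (A.1 m) (B.1 (- m)))).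

Definition mode (x : sl) (n : int) : affine := (delta n x, 0).
Definition central : affine := (0, 1).

Lemma affine_br_mode (a b : sl) (m n : int) :
  affine_br (mode a m) (mode b n) =
  mode (sl_br a b) (m + n)
    + (- (n%:~R * (m + n == 0)%:R * sl_form a b)) *: central.
Proof.
apply: injective_projections => /=.
- apply: finsupp_eqP => p; rewrite finsuppDE finsuppZE scaler0 addr0 /=.
  rewrite -(fsbig_widen [set m]) //; last first.
    by move=> q [_ /= qm]; case: eqP => // _; rewrite sl_br0l.
  rewrite fsbig_set1 eqxx (_ : (p - m == n) = (p == m + n)); last first.
    by rewrite subr_eq addrC.
  by case: eqP => // _; rewrite sl_br0r.
- rewrite add0r [_ *: 1]mulr1 /=.
  have sl0 x : sl_form 0 x = 0 by rewrite /sl_form vsval0 mul0mx mxtrace0.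
  have sl0r x : sl_form x 0 = 0 by rewrite /sl_form vsval0 mulmx0 mxtrace0.
  rewrite -(fsbig_widen [set m]) //; last first.
    by move=> q [_ /= qm]; case: eqP => // _; rewrite sl0 mulr0.
  rewrite fsbig_set1 eqxx eqr_oppLR -addr_eq0.
  case: eqP => [/eqP|_]; last by rewrite sl0r !(mulr0, mul0r) oppr0.
  by rewrite addr_eq0 => /eqP ->; rewrite mulr1 rmorphN mulNr.
Qed.

Lemma affine_br_centrall (A : affine) c : affine_br (0, c) A = 0.
Proof.
congr (_, _); first apply: finsupp_eqP => p /=; rewrite fsbig1 // => m _ /=.
  by rewrite sl_br0l.
by rewrite /sl_form vsval0 mul0mx mxtrace0 mulr0.
Qed.

Lemma affine_br_centralr (A : affine) c : affine_br A (0, c) = 0.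
Proof.
congr (_, _); first apply: finsupp_eqP => p /=; rewrite fsbig1 // => m _ /=.
  by rewrite sl_br0r.
by rewrite /sl_form vsval0 mulmx0 mxtrace0 mulr0.
Qed.

End Affine.

Section Vacuum.
Variables (K : numFieldType) (M N : nat) (k : 'I_N -> K).

Definition affineN := {ffun 'I_N -> affine K M}.
HB.instance Definition _ := GRing.Lmodule.on affineN.

Definition affineN_br (A B : affineN) : affineN :=
  [ffun i => affine_br (A i) (B i)].

Definition copy (i : 'I_N) (A : affine K M) : affineN :=
  [ffun j => if j == i then A else 0].

(* (sl_M[t] + C k)^N, and the character by which it acts on the vacuum line *)
Definition affineN_nonneg : set affineN :=
  [set A : affineN | forall i (m : int), m < 0 -> (A i).1 m = 0].

Definition level (A : affineN) : K := \sum_i k i * (A i).2.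

(* V_0^k, with highest weight vector [vacuum] = |0>^k *)
Definition vacmod := indmod affineN_br affineN_nonneg level.
HB.instance Definition _ := GRing.Lmodule.on vacmod.

Definition vacuum : vacmod := vac _ _ _.

Definition Delta (A : affine K M) : affineN := \sum_i copy i A.

Variable z_ : 'I_N -> K.

(* the operator A(z) = \sum_i A^(i) / (z - z_i) on V_0^k *)
Definition gfield (A : affine K M) (z : K) (v : vacmod) : vacmod :=
  \sum_i (z - z_ i)^-1 *: act (copy i A) v.

Definition twist (z : K) : K := \sum_i k i / (z - z_ i).

End Vacuum.

(* V has no topology.  v is the derivative of f at z when, near z, f is a finite sum of
   coefficients c j, differentiable at z, times fixed vectors e j, and v is
   the sum of the derive1 (c j) z times e j. *)
Section Vderive.
Variables (K : numFieldType) (V : lmodType K).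

Definition is_vderive (f : K -> V) (z : K) (v : V) : Prop :=
  exists (n : nat) (c : 'I_n -> K -> K^o) (e : 'I_n -> V),
    [/\ \forall w \near z, f w = \sum_j c j w *: e j,
        forall j, derivable (c j) z 1 &
        v = \sum_j (derive1 (c j) z : K) *: e j].

Definition vderive (f : K -> V) (z : K) : V := xget 0 [set v | is_vderive f z v].

Lemma vderive0 n (c : 'I_n -> K -> K^o) (e : 'I_n -> V) z :
  (\forall w \near z, \sum_j c j w *: e j = 0) ->
  (forall j, derivable (c j) z 1) ->
  \sum_j (derive1 (c j) z : K) *: e j = 0.
Proof.
elim: n c e => [|n IH] c e hc dc; first by rewrite big_ord0.
have [[a [i0 ai0] ae]|indep] :=
  pselect (exists2 a : 'I_n.+1 -> K, (exists i, a i != 0) & \sum_j a j *: e j = 0).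
- pose b j := - ((a i0)^-1 * a (lift i0 j)).
  have ei0 : e i0 = \sum_j b j *: e (lift i0 j).
    apply: (scalerI ai0); rewrite scaler_sumr; move: ae.
    rewrite (bigD1_ord i0) //= => /eqP; rewrite addr_eq0 => /eqP ->.
    rewrite -sumrN; apply: eq_bigr => j _.
    by rewrite scalerA /b mulrN mulrA mulfV // mul1r scaleNr.
  have split_sum (d : 'I_n.+1 -> K) :
      \sum_j d j *: e j = \sum_j (d (lift i0 j) + b j * d i0) *: e (lift i0 j).
    rewrite (bigD1_ord i0) //= ei0 scaler_sumr -big_split; apply: eq_bigr => j _.
    by rewrite /= scalerA -scalerDl addrC [d i0 * _]mulrC.
  have dz j : derivable (b j \*: c i0) z 1 by exact: derivableZ.
  rewrite split_sum.
  rewrite -[RHS](IH (fun j => c (lift i0 j) + (b j \*: c i0)) (fun j => e (lift i0 j))).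
  + by apply: eq_bigr => j _; rewrite !derive1E deriveD // deriveZ.
  + by apply: filterS hc => w; rewrite split_sum.
  + by move=> j; exact: derivableD.
- apply: big1 => j _; rewrite derive1E (near_eq_derive _ (g := cst 0)).
    by rewrite derive_cst scale0r.
  apply: filterS hc => w hw; apply: contrapT => /eqP cj.
  by apply: indep; exists (c^~ w) => //; exists j.
Qed.

Lemma is_vderive_unique (f : K -> V) z u v :
  is_vderive f z u -> is_vderive f z v -> u = v.
Proof.
move=> [m [c [e [fc dc ->]]]] [n [d [g [fd dd ->]]]].
apply/eqP; rewrite -subr_eq0; apply/eqP.
pose h (s : 'I_m + 'I_n) := match s with inl i => c i | inr j => - d j end.
pose q (s : 'I_m + 'I_n) := match s with inl i => e i | inr j => g j end.
have lq (i : 'I_m) : fintype.split (lshift n i) = inl i :> 'I_m + 'I_n by exact: (@unsplitK m n (inl i)).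
have rq (i : 'I_n) : fintype.split (rshift m i) = inr i :> 'I_m + 'I_n by exact: (@unsplitK m n (inr i)).
have := @vderive0 (m + n) (fun s => h (fintype.split s)) (fun s => q (fintype.split s)) z.
rewrite big_split_ord /=.
under eq_bigr do rewrite lq /=.
under [X in _ + X]eq_bigr do rewrite rq /= derive1E deriveN // scaleNr -derive1E.
rewrite sumrN; apply.
- near=> w; rewrite big_split_ord /=.
  under eq_bigr do rewrite lq /=.
  under [X in _ + X]eq_bigr do rewrite rq /= scaleNr.
  rewrite sumrN; apply/eqP; rewrite subr_eq0; apply/eqP.
  by transitivity (f w); [apply/esym; near: w | near: w].
- by move=> s; case: (fintype.split s) => j //=; exact: derivableN.
Unshelve. all: by end_near. Qed.

Lemma vderiveE (f : K -> V) z v : is_vderive f z v -> vderive f z = v.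
Proof.
by move=> fv; apply: xget_unique => // u fu; exact: is_vderive_unique fu fv.
Qed.

End Vderive.

Section Gaudin.
Variables (K : numFieldType) (M N : nat) (k z_ : 'I_N -> K).

(* D_z^(j) f = f' - (j / M) phi f *)
Definition twderive (j : nat) (f : K -> vacmod M k) (z : K) : vacmod M k :=
  vderive f z - (j%:R / M%:R * twist k z_ z) *: f z.

Variables (d : nat) (I : d.-tuple (sl K M)).

Definition sl_t (a b c : 'I_d) : K :=
  let X a := vsval (tnth I a) in
  \tr (X a *m X b *m X c + X b *m X a *m X c).

Definition varsigma1 (z : K) : vacmod M k :=
  let J a := gfield z_ (mode (tnth I a) (-1)) z in
  2^-1 *: \sum_a J a (J a (vacuum M k)).

Definition varsigma2 (z : K) : vacmod M k :=
  let J a := gfield z_ (mode (tnth I a) (-1)) z in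
  3^-1 *: \sum_a \sum_b \sum_c sl_t a b c *: J a (J b (J c (vacuum M k))).

End Gaudin.

(* Main.v *)
From HB Require Import structures.
Require Import Defs.
From mathcomp Require Import all_boot all_order all_algebra complex.
From mathcomp Require Import boolp classical_sets reals.
From mathcomp Require Import topology normedtype derive ring.

Set Implicit Arguments.
Unset Strict Implicit.
Unset Printing Implicit Defensive.

Import Order.TTheory GRing.Theory Num.Theory.
Local Open Scope ring_scope.

(** Write A_m^[r] for the operator sum_i (z - z_i)^-r A_m^(i) on the vacuum
module, so that A_(-1)(z) = A_(-1)^[1] and Delta x_n = x_n^[0].  These
operators satisfy the single commutation rule
[[
  [A_m^[r], B_n^[s]] = [A, B]_(m+n)^[r+s] - n delta_(m+n,0) (A|B) kappa_(r+s)
]]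
with kappa_r = sum_i k_i (z - z_i)^-r ([emode_comm]); in particular kappa_1 is
the twist function.  Moreover A_m^[r] kills the vacuum for m >= 0, and
d/dz A_(-1)^[1] = - A_(-1)^[2].  Both identities are obtained by commuting
x_n^[0] to the right through the factors I^a_(-1)^[1].

Each factor produces a central term (x|I^a) kappa_1, present only for n = 1:
together these terms give the part of the twisted derivative that involves the
twist function.  Each factor also produces a term [x, I^a]_(n-1)^[1].  For n = 0
these add up to zero, because the trace form and t are invariant.  For n >= 1 they
are commuted further to the right, which leaves the double
brackets [[x, I^a], I^b]_(n-2)^[2]; these contract through
  - sum_a [[x, I^a], I^a] = 2 M x   ([sl_casimir]),
  - t_abc [[x, I^a], I^b] = M (x o I^c)   ([sl_t3_contract]),
where x o y = sum_a t(I_a, x, y) I_a is the traceless part of xy + yx.  For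
n = 1 the result is the derivative of the stated vector.  For n >= 2 only modes
that kill the vacuum remain, together with contractions that vanish since t is
symmetric and the bracket antisymmetric, or because x is traceless. *)

(** * Linear maps given by a proof of linearity *)

Lemma linear_sumZ (K : pzRingType) (U V : lmodType K) (f : U -> V) (T : finType)
    (a : T -> K) (u : T -> U) :
  linear f -> f (\sum_j a j *: u j) = \sum_j a j *: f (u j).
Proof.
move=> fL.
pose f' : {linear U -> V} := HB.pack f (GRing.isLinear.Build K U V _ f fL).
rewrite -[f]/(f' : U -> V) linear_sum; apply: eq_bigr => j _.
by rewrite linearZ.
Qed.

(** * Identities for a cyclic trace *)

(** Bracket expansions are carried out in an abstract ring with a cyclic additive
map; they are later used for square matrices. *)

Section CyclicTrace.
Variables (A : pzRingType) (K : comNzRingType) (tr : {additive A -> K}).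
Hypothesis trC : forall p q, tr (p * q) = tr (q * p).
Implicit Types (a b c x y : A).

Let E4 p q r s : tr (p * q * r * s) = tr (q * r * s * p).
Proof. by rewrite -!mulrA trC !mulrA. Qed.

Let E5 p q r s t : tr (p * q * r * s * t) = tr (q * r * s * t * p).
Proof. by rewrite -!mulrA trC !mulrA. Qed.

Lemma trace_t3_inv x a b c :
  tr ((x * a - a * x) * b * c + b * (x * a - a * x) * c)
  + tr (a * (x * b - b * x) * c + (x * b - b * x) * a * c)
  + tr (a * b * (x * c - c * x) + b * a * (x * c - c * x)) = 0.
Proof.
rewrite !raddfD !(mulrBl, mulrBr) !raddfB /= !mulrA !(E4 x).
ring.
Qed.

Lemma trace_br_br x a y :
  tr (((x * a - a * x) * a - a * (x * a - a * x)) * y) =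
  tr (a * a * (y * x)) - tr (a * x * a * y) *+ 2 + tr (a * a * (x * y)).
Proof.
rewrite !(mulrBl, mulrBr) !raddfB /= !mulrA !(E4 x).
ring.
Qed.

(** The double bracket contracted with the cubic form; every term on the right has
the shape b X b Y or b b Y, ready for summation over an orthonormal basis. *)
Lemma trace_t3_br_br x y b c :
  - tr ((x * (b * y - y * b) - (b * y - y * b) * x) * b * c
      + b * (x * (b * y - y * b) - (b * y - y * b) * x) * c) =
  tr (b * b * (c * x * y)) + tr (b * b * (y * x * c))
  + (tr (b * (y * x) * b * c) + tr (b * (x * y) * b * c))
  - (tr (b * y * b * (c * x)) + tr (b * x * b * (c * y)))
  - (tr (b * x * b * (y * c)) + tr (b * y * b * (x * c))).
Proof.
rewrite raddfD !(mulrBl, mulrBr) !raddfB /= !mulrA !(E5 x) !(E5 y).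
ring.
Qed.

End CyclicTrace.

(** * The trace form and the symmetric invariant cubic form of sl_M *)

Section SlForm.
Variables (K : numFieldType) (M : nat).
Implicit Types (x y z u v : sl K M).

Lemma sl_tr0 x : \tr (vsval x) = 0.
Proof. by apply/eqP; rewrite -mem_slv; exact: subvsP. Qed.

Lemma sl_formC x y : sl_form x y = sl_form y x.
Proof. exact: mxtrace_mulC. Qed.

Lemma sl_form_linearl y : linear ((sl_form (M:=M))^~ y : sl K M -> K^o).
Proof.
by move=> a u v; rewrite /sl_form linearP /= mulmxDl -scalemxAl mxtraceD mxtraceZ.
Qed.

Lemma sl_formZl a x y : sl_form (a *: x) y = a * sl_form x y.
Proof. by rewrite /sl_form linearZ /= -scalemxAl mxtraceZ. Qed.

Lemma sl_form_brA x y z : sl_form (sl_br x y) z = sl_form x (sl_br y z).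
Proof.
rewrite /sl_form !sl_brE mulmxBl mulmxBr !raddfB /= !mulmxA.
by rewrite -[vsval y *m _ *m _]mulmxA [\tr (vsval y *m _)]mxtrace_mulC.
Qed.

Lemma sl_brC x y : sl_br x y = - sl_br y x.
Proof.
by apply: val_inj; rewrite /= !sl_brE opprB.
Qed.

Lemma sl_br_linearr x : linear (sl_br x).
Proof.
move=> a u v; apply: val_inj.
rewrite linearP /= !sl_brE [vsval (_ + _)]linearP /= mulmxDl mulmxDr.
rewrite -scalemxAl -scalemxAr.
by rewrite scalerBr opprD addrACA.
Qed.

Lemma sl_br_linearl y : linear ((sl_br (M:=M))^~ y : sl K M -> sl K M).
Proof.
move=> a u v /=; rewrite ![sl_br _ y]sl_brC sl_br_linearr.
by rewrite opprD scalerN.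
Qed.

(** ad x is skew-adjoint for the trace form. *)
Lemma sl_form_br_skew x y z : sl_form (sl_br x y) z = - sl_form (sl_br x z) y.
Proof.
rewrite [sl_br x y]sl_brC /sl_form linearN mulNmx linearN /=; congr (- _).
by rewrite -!/(sl_form _ _) sl_form_brA sl_formC.
Qed.

(** The symmetric cubic form tr(xyz + yxz).  On basis vectors it is convertible
to the structure constant t_abc, that is to [sl_t I a b c]. *)
Definition sl_t3 x y z : K :=
  \tr (vsval x *m vsval y *m vsval z + vsval y *m vsval x *m vsval z).

Lemma sl_t3C12 x y z : sl_t3 x y z = sl_t3 y x z.
Proof. by rewrite /sl_t3 addrC. Qed.

Lemma sl_t3C13 x y z : sl_t3 x y z = sl_t3 z y x.
Proof.
rewrite /sl_t3 !mxtraceD addrC; congr (_ + _).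
  by rewrite [RHS]mxtrace_mulC mulmxA [RHS]mxtrace_mulC !mulmxA.
by rewrite [RHS]mxtrace_mulC !mulmxA.
Qed.

Lemma sl_t3C23 x y z : sl_t3 x y z = sl_t3 x z y.
Proof. by rewrite sl_t3C12 sl_t3C13 sl_t3C12. Qed.

Lemma sl_t3_linear1 y z : linear (fun x => sl_t3 x y z : K^o).
Proof.
move=> a u v; rewrite /sl_t3 linearP /= !(mulmxDl, mulmxDr).
rewrite -!(scalemxAl, scalemxAr) !(mxtraceD, mxtraceZ).
by rewrite [_ *: (_ : K^o)]mulrDr addrACA.
Qed.

Lemma sl_t3_inv x a b c :
  sl_t3 (sl_br x a) b c + sl_t3 a (sl_br x b) c + sl_t3 a b (sl_br x c) = 0.
Proof.
rewrite /sl_t3 !sl_brE.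
exact: (@trace_t3_inv 'M[K]_M K mxtrace (@mxtrace_mulC _ _ _)).
Qed.

End SlForm.

(** * Completeness relations for an orthonormal basis *)

Section OrthonormalBasis.
Variables (K : numFieldType) (M d : nat) (I : d.-tuple (sl K M)).
Hypothesis M_neq0 : M%:R != 0 :> K.
Hypothesis I_basis : basis_of fullv I.
Hypothesis I_orth : forall a b, sl_form (tnth I a) (tnth I b) = (a == b)%:R.
Implicit Types (x y z u v : sl K M).

Local Notation e a := (tnth I a).

Lemma sl_expand x : x = \sum_a sl_form x (e a) *: e a.
Proof.
have xE := coord_basis I_basis (memvf x).
rewrite {1}xE; apply: eq_bigr => a _; rewrite (tnth_nth 0); congr (_ *: _).
rewrite {2}xE (linear_sumZ _ _ (sl_form_linearl _)) (bigD1 a) //= big1 => [|b ba].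
  rewrite -!tnth_nth I_orth eqxx addr0.
  by rewrite [RHS]mulr1.
by rewrite -!tnth_nth I_orth (negPf ba) scaler0.
Qed.

Lemma sl_linear_expand (V : lmodType K) (f : sl K M -> V) x :
  linear f -> \sum_a sl_form x (e a) *: f (e a) = f x.
Proof. by move=> fL; rewrite {2}[x]sl_expand linear_sumZ. Qed.

Lemma sl_form_inj x y : (forall u, sl_form x u = sl_form y u) -> x = y.
Proof.
by move=> xy; rewrite [x]sl_expand [y]sl_expand; apply: eq_bigr => a _; rewrite xy.
Qed.

(** Summing tr(I_a X) I_a projects a matrix X onto its traceless part. *)
Lemma sl_completeness (X : 'M[K]_M) :
  \sum_a \tr (vsval (e a) *m X) *: vsval (e a) = X - (M%:R^-1 * \tr X)%:M.
Proof.
set Y := X - _.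
have trY : Y \in slv K M.
  by rewrite mem_slv raddfB /= mxtrace_scalar -[X in _ - X]mulr_natr mulrAC mulVf // mul1r subrr.
have -> : Y = vsval (vsproj (slv K M) Y) by rewrite vsprojK.
rewrite [in RHS](sl_expand (vsproj _ _)) linear_sum; apply: eq_bigr => a _.
rewrite linearZ /=; congr (_ *: _).
rewrite sl_formC /sl_form vsprojK // mulmxBr raddfB /= mul_mx_scalar.
by rewrite mxtraceZ sl_tr0 mulr0 subr0.
Qed.

(** The completeness relation in coordinates, read off on elementary
matrices. *)
Lemma sl_completeness_entry i j p q :
  \sum_a vsval (e a) i j * vsval (e a) p q =
  ((i == q) && (j == p))%:R - M%:R^-1 * ((i == j) && (p == q))%:R.
Proof.
have := congr1 (fun X : 'M[K]_M => X p q) (sl_completeness (delta_mx j i)).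
rewrite summxE => E.
transitivity (\sum_a (\tr (vsval (e a) *m delta_mx j i) *: vsval (e a)) p q).
  apply: eq_bigr => a _; rewrite mxE; congr (_ * _).
  rewrite /mxtrace (bigD1 i) //= big1 => [|r ri].
    rewrite mxE (bigD1 j) //= big1 => [|s sj].
      by rewrite mxE !eqxx mulr1 !addr0.
    by rewrite mxE (negPf sj) mulr0.
  rewrite mxE big1 // => s _.
  by rewrite mxE (negPf ri) andbF mulr0.
rewrite E !mxE; congr (_ - _); first by rewrite andbC eq_sym [p == _]eq_sym.
rewrite -mulrnAr; congr (_ * _).
rewrite /mxtrace (bigD1 i) //= big1 => [|r ri].
  by rewrite mxE eqxx andbT addr0 -mulrnA mulnb.
by rewrite mxE (negPf ri) andbF.
Qed.

Lemma sl_sandwich (X : 'M[K]_M) :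
  \sum_a vsval (e a) *m X *m vsval (e a) = (\tr X)%:M - M%:R^-1 *: X.
Proof.
apply/matrixP => i l; rewrite summxE !mxE.
transitivity (\sum_j \sum_p X j p * \sum_a vsval (e a) i j * vsval (e a) p l).
  under eq_bigr do rewrite mxE.
  rewrite exchange_big /= [RHS]exchange_big /=; apply: eq_bigr => p _.
  under eq_bigr do rewrite mxE mulr_suml.
  rewrite exchange_big /=; apply: eq_bigr => j _.
  by rewrite mulr_sumr; apply: eq_bigr => a _; rewrite mulrAC mulrA mulrC mulrA.
under eq_bigr do under eq_bigr do rewrite sl_completeness_entry mulrBr.
under eq_bigr do rewrite sumrB.
rewrite sumrB; congr (_ - _).
  rewrite -sumrMnl; apply: eq_bigr => j _.
  rewrite (bigD1 j) //= big1 => [|p pj]; first by rewrite eqxx andbT addr0 mulr_natr.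
  by rewrite [j == p]eq_sym (negPf pj) andbF mulr0.
rewrite (bigD1 i) //= [X in _ + X]big1 => [|j ji].
  rewrite (bigD1 l) //= big1 => [|p pl]; first by rewrite !eqxx !addr0 mulr1 mulrC.
  by rewrite (negPf pl) andbF !mulr0.
by apply: big1 => p _; rewrite [i == j]eq_sym (negPf ji) !mulr0.
Qed.

Lemma sl_trace_sandwich (X Y : 'M[K]_M) :
  \sum_a \tr (vsval (e a) *m X *m vsval (e a) *m Y) =
  \tr X * \tr Y - M%:R^-1 * \tr (X *m Y).
Proof.
rewrite -raddf_sum -mulmx_suml sl_sandwich mulmxBl raddfB /= mul_scalar_mx.
by rewrite -scalemxAl !mxtraceZ.
Qed.

Lemma sl_trace_square (Y : 'M[K]_M) :
  \sum_a \tr (vsval (e a) *m vsval (e a) *m Y) = (M%:R - M%:R^-1) * \tr Y.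
Proof.
have := sl_trace_sandwich 1%:M Y.
under eq_bigr do rewrite mulmx1.
by move->; rewrite mxtrace1 mul1mx mulrBl.
Qed.

End OrthonormalBasis.

(** * Contractions over an orthonormal basis *)

Section Contractions.
Variables (K : numFieldType) (M d : nat) (I : d.-tuple (sl K M)).
Hypothesis M_neq0 : M%:R != 0 :> K.
Hypothesis I_basis : basis_of fullv I.
Hypothesis I_orth : forall a b, sl_form (tnth I a) (tnth I b) = (a == b)%:R.
Implicit Types (x y z u v : sl K M).

Local Notation e a := (tnth I a).

Lemma sum_antisym (V : lmodType K) (F : 'I_d -> 'I_d -> V) :
  (forall a b, F a b = - F b a) -> \sum_a \sum_b F a b = 0.
Proof.
move=> FN; set S := \sum_a _.
have SN : S = - S.
  rewrite {1}/S exchange_big /= -sumrN; apply: eq_bigr => a _.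
  by rewrite -sumrN; apply: eq_bigr => b _; exact: FN.
have : (2%:R : K) *: S = 0 by rewrite scaler_nat mulr2n {2}SN subrr.
by move/eqP; rewrite scaler_eq0 pnatr_eq0 /= => /eqP.
Qed.

(** The Casimir element acts on the adjoint representation by 2M. *)
Lemma sl_casimir x :
  \sum_a sl_br (sl_br x (e a)) (e a) = (2%:R * M%:R) *: x.
Proof.
apply: (sl_form_inj I_basis I_orth) => y.
transitivity (\sum_a sl_form (sl_br (sl_br x (e a)) (e a)) y).
  rewrite -[X in sl_form X y](_ : \sum_a 1 *: sl_br (sl_br x (e a)) (e a) = _).
    rewrite (linear_sumZ _ _ (sl_form_linearl y)).
    by apply: eq_bigr => a _; rewrite scale1r.
  by apply: eq_bigr => a _; rewrite scale1r.
transitivity (\sum_a (\tr (vsval (e a) *m vsval (e a) *m (vsval y *m vsval x))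
    - \tr (vsval (e a) *m vsval x *m vsval (e a) *m vsval y) *+ 2
    + \tr (vsval (e a) *m vsval (e a) *m (vsval x *m vsval y)))).
  apply: eq_bigr => a _; rewrite /sl_form !sl_brE.
  exact: (@trace_br_br 'M[K]_M K mxtrace (@mxtrace_mulC _ _ _)).
rewrite big_split sumrB sumrMnl /= !(sl_trace_square M_neq0 I_basis I_orth).
rewrite (sl_trace_sandwich M_neq0 I_basis I_orth) [\tr (vsval y *m _)]mxtrace_mulC.
rewrite sl_tr0 mul0r sl_formZl /sl_form; ring.
Qed.

Lemma sl_br_self x : sl_br x x = 0.
Proof. by apply: val_inj; rewrite /= sl_brE subrr. Qed.

Lemma sl_form_br_self x y : sl_form (sl_br x y) y = 0.
Proof. by rewrite sl_form_brA sl_br_self /sl_form vsval0 mulmx0 mxtrace0. Qed.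

(** The product x o y dual to the cubic form, so that (u|x o y) = t(u, x, y); it
is the traceless part of xy + yx. *)
Definition sl_circ y z : sl K M := \sum_a sl_t3 (e a) y z *: e a.

Lemma sl_form_circ u y z : sl_form u (sl_circ y z) = sl_t3 u y z.
Proof.
rewrite sl_formC /sl_circ (linear_sumZ _ _ (sl_form_linearl _)).
rewrite -(sl_linear_expand I_basis I_orth u (sl_t3_linear1 y z)).
by apply: eq_bigr => a _; rewrite sl_formC [LHS]mulrC.
Qed.

(** The cubic analogue of the Casimir relation. *)
Lemma sl_t3_contract x c :
  \sum_a \sum_b sl_t3 (e a) (e b) c *: sl_br (sl_br x (e a)) (e b) =
  M%:R *: sl_circ x c.
Proof.
apply: (sl_form_inj I_basis I_orth) => y.
rewrite pair_bigA /= (linear_sumZ _ _ (sl_form_linearl y)).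
rewrite -(pair_bigA _ (fun a b => sl_t3 (e a) (e b) c *:
  (sl_form (sl_br (sl_br x (e a)) (e b)) y : K^o))) exchange_big /=.
(* The sum over a is performed first: moving brackets across the trace form
   replaces e a in the cubic form by - [x, [e b, y]]. *)
transitivity (\sum_b - sl_t3 (sl_br x (sl_br (e b) y)) (e b) c).
  apply: eq_bigr => b _.
  rewrite -(sl_linear_expand I_basis I_orth _ (sl_t3_linear1 (e b) c)) -sumrN.
  apply: eq_bigr => a _; rewrite sl_form_brA sl_form_br_skew.
  by rewrite [LHS]mulrN [X in - X]mulrC.
transitivity (\sum_b (
    \tr (vsval (e b) *m vsval (e b) *m (vsval c *m vsval x *m vsval y))
  + \tr (vsval (e b) *m vsval (e b) *m (vsval y *m vsval x *m vsval c))
  + (\tr (vsval (e b) *m (vsval y *m vsval x) *m vsval (e b) *m vsval c)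
  + \tr (vsval (e b) *m (vsval x *m vsval y) *m vsval (e b) *m vsval c))
  - (\tr (vsval (e b) *m vsval y *m vsval (e b) *m (vsval c *m vsval x))
  + \tr (vsval (e b) *m vsval x *m vsval (e b) *m (vsval c *m vsval y)))
  - (\tr (vsval (e b) *m vsval x *m vsval (e b) *m (vsval y *m vsval c))
  + \tr (vsval (e b) *m vsval y *m vsval (e b) *m (vsval x *m vsval c))))).
  apply: eq_bigr => b _; rewrite /sl_t3 !sl_brE.
  exact: (@trace_t3_br_br 'M[K]_M K mxtrace (@mxtrace_mulC _ _ _)).
rewrite !sumrB !big_split /= !(sl_trace_square M_neq0 I_basis I_orth).
rewrite !(sl_trace_sandwich M_neq0 I_basis I_orth) !sl_tr0.
rewrite sl_formZl [sl_form (sl_circ _ _) y]sl_formC sl_form_circ /sl_t3 mxtraceD.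
rewrite !mulmxA.
have E (P Q S : 'M[K]_M) : \tr (P *m Q *m S) = \tr (Q *m S *m P).
  by rewrite -mulmxA mxtrace_mulC.
rewrite !(E (vsval c)) [\tr (vsval y *m vsval c *m vsval x)]E.
rewrite [\tr (vsval y *m vsval x *m vsval c)]E.
rewrite !(E (vsval c)).
by field.
Qed.

Lemma sl_circ_br x : \sum_c sl_br (sl_circ x (e c)) (e c) = 0.
Proof.
rewrite -[RHS](@sum_antisym _ (fun c a => sl_t3 (e a) x (e c) *: sl_br (e a) (e c))).
  apply: eq_bigr => c _.
  by rewrite /sl_circ (linear_sumZ _ _ (sl_br_linearl _)).
by move=> a b; rewrite sl_brC sl_t3C13 scalerN.
Qed.

Lemma sl_circ_form x : \sum_c sl_form (sl_circ x (e c)) (e c) = 0.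
Proof.
transitivity (\sum_c 2%:R * \tr (vsval (e c) *m vsval (e c) *m vsval x)).
  apply: eq_bigr => c _; rewrite sl_formC sl_form_circ /sl_t3 mxtraceD.
  rewrite mxtrace_mulC -mulmxA [\tr (vsval x *m _)]mxtrace_mulC !mulmxA.
  by rewrite mulr_natl mulr2n.
by rewrite -mulr_sumr (sl_trace_square M_neq0 I_basis I_orth) sl_tr0 !mulr0.
Qed.

Lemma sl_t3_br_form x c :
  \sum_a \sum_b sl_t3 (e a) (e b) c * sl_form (sl_br x (e a)) (e b) = 0.
Proof.
apply: (@sum_antisym K^o) => a b; rewrite sl_t3C12 -mulrN; congr (_ * _).
exact: sl_form_br_skew.
Qed.

Section Multilinear.
Variable V : lmodType K.

(** In a contraction over an orthonormal basis, ad x moves from one factor to the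
other at the price of a sign. *)
Lemma sl_transport (h : sl K M -> K^o) (G : sl K M -> V) x :
  linear h -> linear G ->
  \sum_a h (e a) *: G (sl_br x (e a)) = - \sum_a h (sl_br x (e a)) *: G (e a).
Proof.
move=> hL GL.
transitivity (\sum_a \sum_b (h (e a) * sl_form (sl_br x (e a)) (e b)) *: G (e b)).
  apply: eq_bigr => a _.
  rewrite -(sl_linear_expand I_basis I_orth (sl_br x (e a)) GL) scaler_sumr.
  by apply: eq_bigr => b _; rewrite scalerA.
rewrite exchange_big /= -sumrN; apply: eq_bigr => b _.
rewrite -scaler_suml -scaleNr; congr (_ *: _).
rewrite -(sl_linear_expand I_basis I_orth (sl_br x (e b)) hL) -sumrN.
apply: eq_bigr => a _; rewrite [LHS]mulrC -[RHS]mulNr; congr (_ * _).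
exact: sl_form_br_skew.
Qed.

Lemma sl_form_invariant (G : sl K M -> sl K M -> V) x :
  (forall b, linear (fun a => G a b)) -> (forall a, linear (G a)) ->
  \sum_a (G (e a) (sl_br x (e a)) + G (sl_br x (e a)) (e a)) = 0.
Proof.
move=> G1 G2; rewrite big_split /=.
under eq_bigr do rewrite -(sl_linear_expand I_basis I_orth (sl_br x _) (G2 _)).
under [X in _ + X]eq_bigr do
  rewrite -(sl_linear_expand I_basis I_orth (sl_br x _) (G1 _)).
rewrite exchange_big /= -big_split; apply: big1 => a _.
rewrite -big_split; apply: big1 => b _ /=.
by rewrite [sl_form _ (e a)]sl_form_br_skew scaleNr addNr.
Qed.

Lemma sl_t3_invariant (F : sl K M -> sl K M -> sl K M -> V) x :
  (forall b c, linear (fun a => F a b c)) ->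
  (forall a c, linear (fun b => F a b c)) ->
  (forall a b, linear (fun c => F a b c)) ->
  \sum_a \sum_b \sum_c sl_t3 (e a) (e b) (e c) *:
    (F (sl_br x (e a)) (e b) (e c) + F (e a) (sl_br x (e b)) (e c)
      + F (e a) (e b) (sl_br x (e c))) = 0.
Proof.
move=> F1 F2 F3.
have t1 (b c : sl K M) := sl_t3_linear1 b c.
have t2 (a c : sl K M) : linear (fun b => sl_t3 a b c : K^o).
  by move=> k u v; rewrite ![sl_t3 a _ _]sl_t3C12; exact: t1.
have t3 (a b : sl K M) : linear (fun c => sl_t3 a b c : K^o).
  by move=> k u v; rewrite ![sl_t3 a _ _]sl_t3C13; exact: t1.
under eq_bigr do under eq_bigr do under eq_bigr do rewrite !scalerDr.
under eq_bigr do under eq_bigr do rewrite !big_split.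
under eq_bigr do rewrite !big_split.
rewrite !big_split /=.
rewrite [X in X + _ + _](_ : _ =
  - \sum_a \sum_b \sum_c sl_t3 (sl_br x (e a)) (e b) (e c) *: F (e a) (e b) (e c)); last first.
  rewrite exchange_big /= [in RHS]exchange_big /= -sumrN; apply: eq_bigr => b _.
  rewrite exchange_big /= [in RHS]exchange_big /= -sumrN; apply: eq_bigr => c _.
  exact: (sl_transport x (t1 _ _) (F1 _ _)).
rewrite [X in _ + X + _](_ : _ =
  - \sum_a \sum_b \sum_c sl_t3 (e a) (sl_br x (e b)) (e c) *: F (e a) (e b) (e c)); last first.
  rewrite -sumrN; apply: eq_bigr => a _.
  rewrite exchange_big /= [in RHS]exchange_big /= -sumrN; apply: eq_bigr => c _.
  exact: (sl_transport x (t2 _ _) (F2 _ _)).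
rewrite [X in _ + X](_ : _ =
  - \sum_a \sum_b \sum_c sl_t3 (e a) (e b) (sl_br x (e c)) *: F (e a) (e b) (e c)); last first.
  rewrite -sumrN; apply: eq_bigr => a _; rewrite -sumrN; apply: eq_bigr => b _.
  exact: (sl_transport x (t3 _ _) (F3 _ _)).
rewrite -!opprD -!big_split /= big1 ?oppr0 // => a _.
rewrite -!big_split /=; apply: big1 => b _; rewrite -!big_split /=.
by apply: big1 => c _; rewrite -!scalerDl sl_t3_inv scale0r.
Qed.

Lemma sl_circ_swap (G : sl K M -> sl K M -> V) x :
  (forall b, linear (fun a => G a b)) -> (forall a, linear (G a)) ->
  \sum_c G (sl_circ x (e c)) (e c) = \sum_c G (e c) (sl_circ x (e c)).
Proof.
move=> G1 G2.
under eq_bigr do rewrite /sl_circ (linear_sumZ _ _ (G1 _)).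
under [RHS]eq_bigr do rewrite /sl_circ (linear_sumZ _ _ (G2 _)).
rewrite exchange_big /=; apply: eq_bigr => a _; apply: eq_bigr => c _.
by rewrite sl_t3C13.
Qed.

Lemma sl_t3_contract_map (G : sl K M -> V) x c : linear G ->
  \sum_a \sum_b sl_t3 (e a) (e b) c *: G (sl_br (sl_br x (e a)) (e b)) =
  M%:R *: G (sl_circ x c).
Proof.
move=> GL.
have GZ k u : G (k *: u) = k *: G u.
  have G0 : G 0 = 0 by rewrite -(subrr 0) -scaleN1r addrC GL scaleN1r addNr.
  by rewrite -[k *: u]addr0 GL G0 addr0.
rewrite -GZ -sl_t3_contract pair_bigA [in RHS]pair_bigA /=.
by rewrite linear_sumZ.
Qed.

Lemma sl_circ_map (G : sl K M -> V) x c : linear G ->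
  \sum_a \sum_b (sl_t3 (e a) (e b) c * sl_form x (e a)) *: G (e b) =
  G (sl_circ x c).
Proof.
move=> GL; rewrite /sl_circ linear_sumZ // exchange_big /=.
apply: eq_bigr => b _; rewrite -scaler_suml sl_t3C12; congr (_ *: _).
rewrite -(sl_linear_expand I_basis I_orth x (sl_t3_linear1 (e b) c)).
by apply: eq_bigr => a _; rewrite [LHS]mulrC.
Qed.

End Multilinear.
End Contractions.

(** * Modes with poles at the marked points *)

Section Modes.
Variables (K : numFieldType) (M N : nat) (k z_ : 'I_N -> K) (z : K).
Implicit Types (A B : sl K M) (v : vacmod M k).

Lemma act_suml (T : finType) (A : T -> affineN K M N) v :
  act (\sum_j A j) v = \sum_j act (A j) v.
Proof.
have aL : linear (fun B : affineN K M N => act B v).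
  by move=> c B C; exact: act_linearl.
under eq_bigr do rewrite -[A _]scale1r.
by rewrite (linear_sumZ _ _ aL); apply: eq_bigr => j _; rewrite scale1r.
Qed.

Lemma act0l v : act (0 : affineN K M N) v = 0.
Proof. by have := act_suml (fun j : 'I_0 => 0) v; rewrite !big_ord0. Qed.

Lemma mode_linear (m : int) : linear ((mode (K:=K) (M:=M))^~ m).
Proof.
move=> c A B; apply: injective_projections => /=; last by rewrite scaler0 addr0.
apply: finsupp_eqP => p; rewrite finsuppDE finsuppZE /=.
by case: eqP => // _; rewrite scaler0 addr0.
Qed.

Lemma copy_linear (i : 'I_N) : linear (copy (K:=K) (M:=M) i).
Proof.
move=> c A B; apply/ffunP => j; rewrite !ffunE.
by case: eqP => // _; rewrite scaler0 addr0.
Qed.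

(** The i-th central element acts on the whole module, and not only on the vacuum,
by k_i. *)
Lemma act_central (i : 'I_N) v : act (copy i (central K M)) v = k i *: v.
Proof.
elim/indmod_ind: v => [|c u v IHu IHv|x v IHv].
- rewrite act_vac; last by move=> j m _; rewrite ffunE; case: eqP.
  congr (_ *: _); rewrite /level (bigD1 i) //= big1 => [|j ji].
    by rewrite ffunE eqxx /= mulr1 addr0.
  by rewrite ffunE (negPf ji) mulr0.
- by rewrite actP IHu IHv scalerDr !scalerA mulrC.
have br0 : affineN_br (copy i (central K M)) x = 0.
  by apply/ffunP => j; rewrite !ffunE; case: eqP => _; exact: affine_br_centrall.
have := act_br (copy i (central K M)) x v; rewrite br0 IHv.
rewrite act0l.
by move/esym/eqP; rewrite subr_eq0 => /eqP ->; rewrite linearZ.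
Qed.

Lemma affineN_br_copy (i j : 'I_N) (A B : affine K M) :
  affineN_br (copy i A) (copy j B) = if i == j then copy i (affine_br A B) else 0.
Proof.
have br0l C : affine_br (0 : affine K M) C = 0 by exact: affine_br_centrall.
have br0r C : affine_br C (0 : affine K M) = 0 by exact: affine_br_centralr.
apply/ffunP => l; rewrite !ffunE; case: (eqVneq i j) => [<-|ij]; rewrite ffunE.
  by case: (l == i); rewrite ?br0l.
case: (eqVneq l i) => [->|_]; last exact: br0l.
by rewrite (negPf ij); exact: br0r.
Qed.

(** The operator A_m^[r] = sum_i (z - z_i)^-r A_m^(i).  The case r = 1 is A_m(z)
and the case r = 0 is the diagonal action of A_m. *)
Definition emode (A : sl K M) (m : int) (r : nat) (v : vacmod M k) : vacmod M k :=
  \sum_i (z - z_ i) ^- r *: act (copy i (mode A m)) v.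

(** The scalar kappa_r = sum_i k_i (z - z_i)^-r by which sum_i (z - z_i)^-r k^(i)
acts; the case r = 1 is the twist function. *)
Definition twist_pow (r : nat) : K := \sum_i k i * (z - z_ i) ^- r.

Lemma emode_linearr A m r : linear (emode A m r).
Proof.
move=> c u v; rewrite /emode scaler_sumr -big_split /=; apply: eq_bigr => i _.
by rewrite actP scalerDr !scalerA mulrC.
Qed.

Lemma emode_linearl m r v : linear (fun A => emode A m r v).
Proof.
move=> c A B; rewrite /emode scaler_sumr -big_split /=; apply: eq_bigr => i _.
by rewrite mode_linear copy_linear act_linearl scalerDr !scalerA mulrC.
Qed.

(** Only pairs of equal marked points contribute, whence the exponent r + s. *)
Lemma emode_comm A B m n r s v :
  emode A m r (emode B n s v) =
  emode B n s (emode A m r v) + emode (sl_br A B) (m + n) (r + s) v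
  - (n%:~R * (m + n == 0)%:R * sl_form A B * twist_pow (r + s)) *: v.
Proof.
have actS (i : 'I_N) (T : finType) (a : T -> K) (u : T -> vacmod M k) C :
    act (copy i C) (\sum_j a j *: u j) = \sum_j a j *: act (copy i C) (u j).
  by rewrite linear_sum; apply: eq_bigr => j _; rewrite linearZ.
suff E : emode A m r (emode B n s v) - emode B n s (emode A m r v) =
    emode (sl_br A B) (m + n) (r + s) v
    - (n%:~R * (m + n == 0)%:R * sl_form A B * twist_pow (r + s)) *: v.
  by rewrite -addrA -E addrC subrK.
rewrite /emode /twist_pow; under eq_bigr do rewrite actS scaler_sumr.
under [X in _ - X]eq_bigr do rewrite actS scaler_sumr.
rewrite [X in _ - X]exchange_big /= -sumrB.
rewrite mulr_sumr scaler_suml -sumrB; apply: eq_bigr => i _.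
rewrite -sumrB (bigD1 i) //= big1 => [|j ji]; last first.
  rewrite !scalerA mulrC -scalerBr -act_br affineN_br_copy eq_sym (negPf ji).
  by rewrite act0l scaler0.
rewrite addr0 !scalerA [_ ^- s * _]mulrC -scalerBr -act_br affineN_br_copy eqxx.
rewrite affine_br_mode [X in copy i X]addrC copy_linear act_linearl act_central.
rewrite scalerDr addrC !scalerA -scaleNr -invfM -exprD.
by congr (_ + _ *: _); ring.
Qed.

Lemma emode_vacuum A m r : 0 <= m -> emode A m r (vacuum M k) = 0.
Proof.
move=> m0; apply: big1 => i _; rewrite act_vac.
  rewrite (_ : level _ _ = 0) ?scale0r ?scaler0 //; apply: big1 => j _.
  by rewrite ffunE; case: eqP => _; rewrite mulr0.
move=> j p p0; rewrite ffunE; case: eqP => // _ /=; case: eqP => // pm.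
by move: p0; rewrite pm ltNge m0.
Qed.

Lemma emode0 A m r : emode A m r 0 = 0.
Proof. by apply: big1 => i _; rewrite act0 scaler0. Qed.

Lemma emodeD A m r u v : emode A m r (u + v) = emode A m r u + emode A m r v.
Proof. by have := emode_linearr A m r 1 u v; rewrite !scale1r. Qed.

Lemma emodeZ A m r c v : emode A m r (c *: v) = c *: emode A m r v.
Proof. by have := emode_linearr A m r c v 0; rewrite emode0 !addr0. Qed.

Lemma emodeZl c A m r v : emode (c *: A) m r v = c *: emode A m r v.
Proof.
have E0 : emode 0 m r v = 0.
  by have := emode_linearl m r v (- 1) 0 0; rewrite scaler0 addr0 scaleN1r addNr.
by have := emode_linearl m r v c A 0; rewrite E0 !addr0.
Qed.

Lemma emode_sum A m r (T : finType) (u : T -> vacmod M k) :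
  emode A m r (\sum_j u j) = \sum_j emode A m r (u j).
Proof.
under eq_bigr do rewrite -[u _]scale1r.
rewrite (linear_sumZ _ _ (emode_linearr A m r)).
by under eq_bigr do rewrite scale1r.
Qed.

Lemma emode_suml m r (T : finType) (B : T -> sl K M) v :
  emode (\sum_j B j) m r v = \sum_j emode (B j) m r v.
Proof.
under eq_bigr do rewrite -[B _]scale1r.
rewrite (linear_sumZ _ _ (@emode_linearl m r v)).
by under eq_bigr do rewrite scale1r.
Qed.

Lemma Delta_emode A m v : act (Delta N (mode A m)) v = emode A m 0 v.
Proof. by rewrite /Delta act_suml; apply: eq_bigr => i _; rewrite expr0 invr1 scale1r. Qed.

Lemma gfield_emode A m v : gfield z_ (mode A m) z v = emode A m 1 v.
Proof. by []. Qed.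

Lemma twist_powE : twist k z_ z = twist_pow 1.
Proof. by []. Qed.

End Modes.

(** * Derivatives of the operators in z *)

Import numFieldNormedType.Exports.

Section Derivatives.
Variable K : numFieldType.

Lemma is_derive_inv_sub (a z : K) : z != a ->
  is_derive (z : K^o) (1 : K^o) (fun w : K^o => (w - a)^-1 : K^o) (- (z - a) ^- 2).
Proof.
move=> za.
have sub_neq0 : z - a != 0 by rewrite subr_eq0.
have D : is_derive (z : K^o) (1 : K^o) (fun w : K^o => w - a : K^o) 1.
  rewrite -[X in is_derive _ _ _ X]subr0.
  exact: (is_deriveB (is_derive_id _ _) (is_derive_cst _ _ _)).
apply: DeriveDef; first exact: derivableV.
by rewrite deriveV // (derive_val (is_derive := D)) [LHS]mulr1.
Qed.

Lemma is_vderive_fin (V : lmodType K) (T : finType) (c : T -> K -> K^o)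
    (dc : T -> K) (e : T -> V) (f : K -> V) (z : K) :
  (forall w, f w = \sum_t c t w *: e t) ->
  (forall t, is_derive (z : K^o) (1 : K^o) (c t) (dc t)) ->
  is_vderive f z (\sum_t dc t *: e t).
Proof.
move=> fE cD; exists #|T|, (fun j => c (enum_val j)), (fun j => e (enum_val j)).
split.
- by apply: filterE => w; rewrite fE big_enum_val.
- by move=> j; exact: ex_derive.
by rewrite big_enum_val; apply: eq_bigr => j _; rewrite derive1E derive_val.
Qed.

Variables (M N : nat) (k z_ : 'I_N -> K) (z : K).
Hypothesis z_neq : forall i, z != z_ i.

Lemma is_vderive_emode (c : K) (A : sl K M) m (v : vacmod M k) :
  is_vderive (fun w => c *: emode z_ w A m 1 v) z (- c *: emode z_ z A m 2 v).
Proof.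
rewrite /emode scaler_sumr; under eq_bigr do rewrite scalerA.
apply: (is_vderive_fin (c := fun i w => c * (w - z_ i)^-1)).
  by move=> w; rewrite scaler_sumr; apply: eq_bigr => i _; rewrite scalerA.
move=> i; rewrite mulNr -mulrN.
exact: (is_deriveZ c (is_derive_inv_sub (z_neq i))).
Qed.

Lemma is_vderive_emode2 (c : K) (T : finType) (A B : T -> sl K M) m n
    (v : vacmod M k) :
  is_vderive
    (fun w => c *: \sum_t emode z_ w (A t) m 1 (emode z_ w (B t) n 1 v)) z
    (- c *: \sum_t (emode z_ z (A t) m 2 (emode z_ z (B t) n 1 v)
                    + emode z_ z (A t) m 1 (emode z_ z (B t) n 2 v))).
Proof.
have emode2E w r s t : emode z_ w (A t) m r (emode z_ w (B t) n s v) =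
    \sum_i \sum_j ((w - z_ i) ^- r * (w - z_ j) ^- s) *:
      act (copy i (mode (A t) m)) (act (copy j (mode (B t) n)) v).
  apply: eq_bigr => i _; rewrite /emode linear_sum scaler_sumr.
  by apply: eq_bigr => j _; rewrite linearZ scalerA.
pose e (p : T * ('I_N * 'I_N)) : vacmod M k :=
  act (copy p.2.1 (mode (A p.1) m)) (act (copy p.2.2 (mode (B p.1) n)) v).
rewrite (_ : _ *: _ = \sum_p (- c * ((z - z_ p.2.1) ^- 2 * (z - z_ p.2.2)^-1
  + (z - z_ p.2.1)^-1 * (z - z_ p.2.2) ^- 2)) *: e p); last first.
  rewrite scaler_sumr -(pair_bigA _ (fun t p => (- c *
    ((z - z_ p.1) ^- 2 * (z - z_ p.2)^-1 + (z - z_ p.1)^-1 * (z - z_ p.2) ^- 2))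
    *: e (t, p))) /=; apply: eq_bigr => t _.
  rewrite !emode2E -big_split scaler_sumr /=.
  rewrite -(pair_bigA _ (fun i j => (- c *
    ((z - z_ i) ^- 2 * (z - z_ j)^-1 + (z - z_ i)^-1 * (z - z_ j) ^- 2))
    *: e (t, (i, j)))) /=; apply: eq_bigr => i _.
  rewrite -big_split scaler_sumr /=; apply: eq_bigr => j _.
  by rewrite -scalerDl scalerA.
apply: (is_vderive_fin (c := fun p w => c * ((w - z_ p.2.1)^-1 * (w - z_ p.2.2)^-1))).
  move=> w; rewrite scaler_sumr -(pair_bigA _ (fun t p => (c *
    ((w - z_ p.1)^-1 * (w - z_ p.2)^-1)) *: e (t, p))) /=.
  apply: eq_bigr => t _; rewrite emode2E scaler_sumr.
  rewrite -(pair_bigA _ (fun i j => (c *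
    ((w - z_ i)^-1 * (w - z_ j)^-1)) *: e (t, (i, j)))) /=.
  apply: eq_bigr => i _; rewrite scaler_sumr; apply: eq_bigr => j _.
  by rewrite scalerA.
move=> [t [i j]] /=.
rewrite (_ : - c * _ = c * ((z - z_ i)^-1 * (- (z - z_ j) ^- 2)
  + (z - z_ j)^-1 * (- (z - z_ i) ^- 2))); last by ring.
exact: (is_deriveZ c (is_deriveM (is_derive_inv_sub (z_neq i))
                                 (is_derive_inv_sub (z_neq j)))).
Qed.

End Derivatives.

(** * The action of x_n on the quadratic and cubic vectors *)

Section SegalSugawara.
Variables (K : numFieldType) (M N : nat) (k z_ : 'I_N -> K).
Variables (d : nat) (I : d.-tuple (sl K M)).
Hypothesis M_neq0 : M%:R != 0 :> K.
Hypothesis I_basis : basis_of fullv I.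
Hypothesis I_orth : forall a b, sl_form (tnth I a) (tnth I b) = (a == b)%:R.
Variable z : K.
Implicit Types (A B x : sl K M) (v : vacmod M k).

Local Notation e a := (tnth I a).
Local Notation E := (@emode K M N k z_ z).
Local Notation kap := (twist_pow k z_ z).
Local Notation v0 := (vacuum M k).
Local Notation J A := (E A (-1) 1).
Local Notation circ x c := (sl_circ I x c).

Lemma emode_commN1 A B m r s v :
  E A m r (E B (-1) s v) = E B (-1) s (E A m r v) + E (sl_br A B) (m - 1) (r + s) v
    + ((m == 1)%:R * kap (r + s) * sl_form A B) *: v.
Proof.
rewrite emode_comm -scaleNr subr_eq0; congr (_ + _ *: _); ring.
Qed.

Lemma emode_emode_linearl A m r n s v : linear (fun B => E A m r (E B n s v)).
Proof. by move=> c B C; rewrite emode_linearl emodeD emodeZ. Qed.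

(** The quadratic vector, without its factor 1/2. *)
Lemma emode_varsigma1 x (n : nat) :
  E x n%:Z 0 (\sum_a J (e a) (J (e a) v0)) =
  (n == 1)%N%:R *: ((2%:R * kap 1) *: J x v0 + (2%:R * M%:R) *: E x (-1) 2 v0).
Proof.
rewrite emode_sum.
(* bracket terms and central terms *)
transitivity (\sum_a (J (e a) (E (sl_br x (e a)) (n%:Z - 1) 1 v0)
    + E (sl_br x (e a)) (n%:Z - 1) 1 (J (e a) v0))
  + \sum_a sl_form x (e a) *: (((n == 1)%N%:R * (2%:R * kap 1)) *: J (e a) v0)).
  rewrite -big_split; apply: eq_bigr => a _ /=.
  rewrite !(emode_commN1 x) add0n (emode_vacuum _ _ _ _ (m := n%:Z)) // emode0 add0r.
  rewrite !emodeD emodeZ -!addrA; congr (_ + _); rewrite addrCA; congr (_ + _).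
  rewrite -scalerDl scalerA; congr (_ *: _).
  by rewrite -[n%:Z == 1]/(n == 1)%N; ring.
rewrite (sl_linear_expand I_basis I_orth x
  (f := fun A => ((n == 1)%N%:R * (2%:R * kap 1)) *: J A v0)); last first.
  by move=> c A B; rewrite emode_linearl scalerDr !scalerA [_ * c]mulrC.
case: n => [|n].
  rewrite (sl_form_invariant I_basis I_orth (G := fun A B => J A (J B v0))).
  - by rewrite !mul0r !scale0r addr0.
  - by move=> B; exact: emode_linearl.
  - by move=> A; exact: emode_emode_linearl.
rewrite (_ : n.+1%:Z - 1 = n%:Z); last by rewrite -addn1 PoszD addrK.
transitivity (E ((2%:R * M%:R) *: x) (n%:Z - 1) 2 v0
  + ((n.+1 == 1)%N%:R * (2%:R * kap 1)) *: J x v0).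
  congr (_ + _); rewrite -(sl_casimir M_neq0 I_basis I_orth) emode_suml.
  apply: eq_bigr => a _; rewrite emode_commN1 emode_vacuum // !emode0 !add0r.
  by rewrite sl_form_br_self mulr0 scale0r addr0.
case: n => [|n].
  rewrite !scale1r mul1r addrC; congr (_ + _).
  exact: emodeZl.
by rewrite emode_vacuum // mul0r !scale0r addr0.
Qed.

(** The commutator terms cancel because [x o I_c, I_c] and (x o I_c|I_c) sum to
zero over c. *)
Lemma emode_circ_comm x m :
  \sum_c E (circ x (e c)) m 2 (J (e c) v0) =
  \sum_c J (e c) (E (circ x (e c)) m 2 v0).
Proof.
under eq_bigr do rewrite emode_commN1.
rewrite !big_split /= -emode_suml -scaler_suml -mulr_sumr.
rewrite sl_circ_br sl_circ_form // mulr0 scale0r addr0.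
by rewrite -[0 : sl K M](scale0r 0) emodeZl scale0r addr0.
Qed.

(** The contraction of a double bracket is unaffected by the central term which
accompanies it in a commutator: that term is antisymmetric in a and b. *)
Lemma sum_t3_contract_shift (G : sl K M -> vacmod M k) x c (s : K) v :
  linear G ->
  \sum_a \sum_b sl_t3 (e a) (e b) c *:
    (G (sl_br (sl_br x (e a)) (e b)) + (s * sl_form (sl_br x (e a)) (e b)) *: v) =
  M%:R *: G (circ x c).
Proof.
move=> GL; rewrite -sl_t3_contract_map // -[RHS]addr0.
under eq_bigr do under eq_bigr do rewrite scalerDr scalerA mulrCA.
under eq_bigr do rewrite big_split.
rewrite big_split /=; congr (_ + _).
under eq_bigr do rewrite -scaler_suml -mulr_sumr.
by rewrite -scaler_suml -mulr_sumr (sl_t3_br_form I x c) mulr0 scale0r.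
Qed.

(** The part of the action of x_(n+1) on the cubic vector that carries no
factor (x|I^a): here n is one less than the index of the mode that acts. *)
Lemma emode_varsigma2_bracket x (n : nat) :
  \sum_a \sum_b \sum_c sl_t3 (e a) (e b) (e c) *:
    (E (sl_br x (e a)) n%:Z 1 (J (e b) (J (e c) v0))
     + J (e a) (E (sl_br x (e b)) n%:Z 1 (J (e c) v0))
     + J (e a) (J (e b) (E (sl_br x (e c)) n%:Z 1 v0))) =
  (3%:R * M%:R) *: \sum_c J (e c) (E (circ x (e c)) (n%:Z - 1) 2 v0).
Proof.
set s := (n%:Z == 1)%:R * kap 2.
pose Y a b := E (sl_br (sl_br x (e a)) (e b)) (n%:Z - 1) 2 v0
  + (s * sl_form (sl_br x (e a)) (e b)) *: v0.
have XJ a b : E (sl_br x (e a)) n%:Z 1 (J (e b) v0) = Y a b.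
  by rewrite emode_commN1 emode_vacuum // emode0 add0r.
transitivity (\sum_a \sum_b \sum_c sl_t3 (e a) (e b) (e c) *:
    (E (sl_br (sl_br x (e a)) (e b)) (n%:Z - 1) 2 (J (e c) v0)
     + (s * sl_form (sl_br x (e a)) (e b)) *: J (e c) v0)
  + \sum_a \sum_b \sum_c sl_t3 (e a) (e b) (e c) *: J (e b) (Y a c)
  + \sum_a \sum_b \sum_c sl_t3 (e a) (e b) (e c) *: J (e a) (Y b c)).
  rewrite -!big_split; apply: eq_bigr => a _ /=.
  rewrite -!big_split; apply: eq_bigr => b _ /=.
  rewrite -!big_split; apply: eq_bigr => c _ /=.
  rewrite -!scalerDr XJ emode_commN1 XJ [E (sl_br x (e c)) _ _ _]emode_vacuum //.
  rewrite !emode0 addr0; congr (_ *: (_ + _)).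
  by rewrite -addrA addrC.
have YJ b : \sum_a \sum_c sl_t3 (e a) (e c) (e b) *: J (e b) (Y a c) =
    M%:R *: J (e b) (E (circ x (e b)) (n%:Z - 1) 2 v0).
  under eq_bigr do under eq_bigr do rewrite /Y emodeD emodeZ.
  exact: (sum_t3_contract_shift x (e b) s (J (e b) v0) (emode_emode_linearl _ _ _ _ _ _)).
rewrite [X in _ + X](_ : _ = M%:R *: \sum_c J (e c) (E (circ x (e c)) (n%:Z - 1) 2 v0)); last first.
  rewrite scaler_sumr; apply: eq_bigr => a _; rewrite -YJ.
  by apply: eq_bigr => b _; apply: eq_bigr => c _; rewrite sl_t3C12 sl_t3C23.
rewrite [X in _ + X + _](_ : _ =
  M%:R *: \sum_c J (e c) (E (circ x (e c)) (n%:Z - 1) 2 v0)); last first.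
  rewrite scaler_sumr exchange_big; apply: eq_bigr => b _ /=; rewrite -YJ.
  by apply: eq_bigr => a _; apply: eq_bigr => c _; rewrite sl_t3C23.
rewrite [X in X + _ + _](_ : _ = M%:R *: \sum_c J (e c) (E (circ x (e c)) (n%:Z - 1) 2 v0)).
  by rewrite -!scalerDl; congr (_ *: _); ring.
rewrite -emode_circ_comm scaler_sumr.
under eq_bigr do rewrite exchange_big /=.
rewrite exchange_big /=; apply: eq_bigr => c _.
exact: (sum_t3_contract_shift x (e c) s (J (e c) v0) (@emode_linearl _ _ _ _ _ _ _ _ _)).
Qed.

(** The cubic vector, without its factor 1/3. *)
Lemma emode_varsigma2 x (n : nat) :
  E x n%:Z 0 (\sum_a \sum_b \sum_c
    sl_t3 (e a) (e b) (e c) *: J (e a) (J (e b) (J (e c) v0))) =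
  (n == 1)%N%:R *:
    ((3%:R * kap 1) *: \sum_c J (circ x (e c)) (J (e c) v0)
     + (3%:R * M%:R) *: \sum_c J (e c) (E (circ x (e c)) (-1) 2 v0)).
Proof.
set del := (n == 1)%N%:R.
pose X a := E (sl_br x (e a)) (n%:Z - 1) 1.
transitivity (\sum_a \sum_b \sum_c sl_t3 (e a) (e b) (e c) *:
    (X a (J (e b) (J (e c) v0)) + J (e a) (X b (J (e c) v0))
      + J (e a) (J (e b) (X c v0)))
  + (del * kap 1) *:
    (\sum_a \sum_b \sum_c (sl_t3 (e a) (e b) (e c) * sl_form x (e a)) *: J (e b) (J (e c) v0)
   + \sum_a \sum_b \sum_c (sl_t3 (e a) (e b) (e c) * sl_form x (e b)) *: J (e a) (J (e c) v0)
   + \sum_a \sum_b \sum_c (sl_t3 (e a) (e b) (e c) * sl_form x (e c)) *: J (e a) (J (e b) v0))).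
  rewrite -!big_split scaler_sumr -big_split emode_sum; apply: eq_bigr => a _ /=.
  rewrite -!big_split scaler_sumr -big_split emode_sum; apply: eq_bigr => b _ /=.
  rewrite -!big_split scaler_sumr -big_split emode_sum; apply: eq_bigr => c _ /=.
  pose w (a : 'I_d) : K := del * kap 1 * sl_form x (e a).
  transitivity (sl_t3 (e a) (e b) (e c) *:
      (X a (J (e b) (J (e c) v0)) + J (e a) (X b (J (e c) v0))
        + J (e a) (J (e b) (X c v0))
      + (w a *: J (e b) (J (e c) v0) + w b *: J (e a) (J (e c) v0)
        + w c *: J (e a) (J (e b) v0)))); last first.
    rewrite [LHS]scalerDr; congr (_ + _); rewrite !scalerDr !scalerA.
    by congr (_ *: _ + _ *: _ + _ *: _); rewrite /w; ring.
  rewrite emodeZ; congr (_ *: _).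
  rewrite !(emode_commN1 x) add0n (emode_vacuum _ _ _ _ (m := n%:Z)) // !emode0 !add0r.
  rewrite !emodeD !emodeZ.
  by rewrite [LHS](ACl ((5*3*1)*(6*4*2)))%AC.
(* By symmetry of the cubic form, contracting x with any of the three factors
   gives the same vector. *)
have S1 : \sum_a \sum_b \sum_c (sl_t3 (e a) (e b) (e c) * sl_form x (e a)) *:
    J (e b) (J (e c) v0) = \sum_c J (circ x (e c)) (J (e c) v0).
  under eq_bigr do rewrite exchange_big /=.
  rewrite exchange_big /=; apply: eq_bigr => c _.
  exact: (sl_circ_map I_basis I_orth _ _ (@emode_linearl _ _ _ _ _ _ _ _ _)).
have S2 : \sum_a \sum_b \sum_c (sl_t3 (e a) (e b) (e c) * sl_form x (e b)) *:
    J (e a) (J (e c) v0) = \sum_c J (circ x (e c)) (J (e c) v0).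
  rewrite -S1 exchange_big; apply: eq_bigr => a _; apply: eq_bigr => b _.
  by apply: eq_bigr => c _; rewrite sl_t3C12.
have S3 : \sum_a \sum_b \sum_c (sl_t3 (e a) (e b) (e c) * sl_form x (e c)) *:
    J (e a) (J (e b) v0) = \sum_c J (circ x (e c)) (J (e c) v0).
  rewrite -S1; under eq_bigr do rewrite exchange_big /=.
  rewrite exchange_big /=; apply: eq_bigr => a _.
  by apply: eq_bigr => b _; apply: eq_bigr => c _; rewrite sl_t3C13 sl_t3C23.
rewrite S1 S2 S3.
set S := \sum_c J (circ _ _) _.
have SE : (del * kap 1) *: (S + S + S) = del *: ((3%:R * kap 1) *: S).
  by rewrite -mulr2n -mulrSr -scaler_nat !scalerA; congr (_ *: _); ring.
rewrite SE scalerDr addrC; congr (_ + _).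
rewrite /X /del; case: n {del X SE} => [|n].
  rewrite scale0r.
  apply: (sl_t3_invariant I_basis I_orth x (F := fun A B C => J A (J B (J C v0)))).
  - by move=> b c; exact: emode_linearl.
  - by move=> a c; exact: emode_emode_linearl.
  - by move=> a b p A B; rewrite emode_linearl !emodeD !emodeZ.
rewrite (_ : n.+1%:Z - 1 = n%:Z); last by rewrite -addn1 PoszD addrK.
rewrite emode_varsigma2_bracket; case: n => [|n]; first by rewrite scale1r.
rewrite scale0r big1 ?scaler0 // => c _.
by rewrite emode_vacuum ?emode0.
Qed.

End SegalSugawara.

(** * Twisted derivatives *)

Section TwistedDerivative.
Variables (K : numFieldType) (M N : nat) (k z_ : 'I_N -> K).
Variables (d : nat) (I : d.-tuple (sl K M)).
Hypothesis M_neq0 : M%:R != 0 :> K.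
Hypothesis I_basis : basis_of fullv I.
Hypothesis I_orth : forall a b, sl_form (tnth I a) (tnth I b) = (a == b)%:R.
Variables (x : sl K M) (n : nat) (z : K).
Hypothesis z_neq : forall i, z != z_ i.

Local Notation ket0 := (vacuum M k).
Local Notation J a w := (gfield z_ (mode (tnth I a) (-1)) w).

Lemma Delta_varsigma1 :
  act (Delta N (mode x n%:Z)) (varsigma1 k z_ I z) =
    twderive z_ 1
      (fun w => (- M%:R * (n == 1)%N%:R) *: gfield z_ (mode x (-1)) w ket0) z.
Proof.
(* C is kept opaque: its product with the Kronecker delta would otherwise be
   taken for a scaling by the rewriting rules below. *)
have [C CE] : exists C : K, C = - M%:R * (n == 1)%N%:R by eexists.
rewrite -CE (Delta_emode z_ z) /varsigma1 emodeZ.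
rewrite (emode_varsigma1 _ _ M_neq0 I_basis I_orth).
rewrite /twderive (vderiveE (is_vderive_emode z_neq _ _ _ _)) (twist_powE k z_ z).
rewrite (gfield_emode z_ z) -scaleNr !scalerDr !scalerA addrC.
by congr (_ *: _ + _ *: _); rewrite CE; field.
Qed.

Lemma Delta_varsigma2 :
  act (Delta N (mode x n%:Z)) (varsigma2 k z_ I z) =
    twderive z_ 2
      (fun w => (- 2^-1 * M%:R * (n == 1)%N%:R) *:
         \sum_a \sum_b \sum_c
            (sl_t I a b c * sl_form x (tnth I a)) *: J b w (J c w ket0)) z.
Proof.
(* C is kept opaque: its product with the Kronecker delta would otherwise be
   taken for a scaling by the rewriting rules below. *)
have [C CE] : exists C : K, C = - 2^-1 * M%:R * (n == 1)%N%:R by eexists.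
rewrite -CE (Delta_emode z_ z) /varsigma2 emodeZ.
rewrite (emode_varsigma2 _ _ M_neq0 I_basis I_orth).
have cubicE w : \sum_a \sum_b \sum_c
      (sl_t I a b c * sl_form x (tnth I a)) *: J b w (J c w ket0) =
    \sum_c emode z_ w (sl_circ I x (tnth I c)) (-1) 1
              (emode z_ w (tnth I c) (-1) 1 ket0).
  under eq_bigr do rewrite exchange_big /=.
  rewrite exchange_big /=; apply: eq_bigr => c _.
  apply: (sl_circ_map I_basis I_orth (G := fun A =>
    emode z_ w A (-1) 1 (emode z_ w (tnth I c) (-1) 1 ket0))).
  exact: emode_linearl.
rewrite /twderive cubicE; under [X in vderive X]eq_fun do rewrite cubicE.
rewrite (vderiveE (is_vderive_emode2 z_neq _ _ _ _ _ _)).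
rewrite big_split /= emode_circ_comm // (twist_powE k z_ z).
have -> : \sum_c emode z_ z (sl_circ I x (tnth I c)) (-1) 1 (emode z_ z (tnth I c) (-1) 2 ket0) =
    \sum_c emode z_ z (tnth I c) (-1) 1 (emode z_ z (sl_circ I x (tnth I c)) (-1) 2 ket0).
  apply: (sl_circ_swap I (G := fun A B => emode z_ z A (-1) 1 (emode z_ z B (-1) 2 ket0))).
  - by move=> B; exact: emode_linearl.
  - by move=> A; exact: emode_emode_linearl.
rewrite -mulr2n -[_ *+ 2]scaler_nat -scaleNr !scalerDr !scalerA addrC.
by congr (_ *: _ + _ *: _); rewrite CE; field.
Qed.

End TwistedDerivative.

Theorem theorem3p4 (R : realType) (M N : nat) (z_ k : 'I_N -> R[i])
    (d : nat) (I : d.-tuple (sl R[i] M)) :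
  (3 <= M)%N -> (1 <= N)%N -> injective z_ ->
  (forall i, k i != - M%:R) ->
  basis_of fullv I ->
  (forall a b, sl_form (tnth I a) (tnth I b) = (a == b)%:R) ->
  forall (x : sl R[i] M) (n : nat) (z : R[i]), (forall i, z != z_ i) ->
  let ket0 := vacuum M k in
  let J a w := gfield z_ (mode (tnth I a) (-1)) w in
  act (Delta N (mode x n%:Z)) (varsigma1 k z_ I z) =
    twderive z_ 1
      (fun w => (- M%:R * (n == 1)%N%:R) *: gfield z_ (mode x (-1)) w ket0) z
  /\
  act (Delta N (mode x n%:Z)) (varsigma2 k z_ I z) =
    twderive z_ 2
      (fun w => (- 2^-1 * M%:R * (n == 1)%N%:R) *:
         \sum_a \sum_b \sum_c
            (sl_t I a b c * sl_form x (tnth I a)) *: J b w (J c w ket0)) z.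
Proof.
move=> M3 _ _ _ I_basis I_orth x n z z_neq ket0 J.
have M_neq0 : M%:R != 0 :> R[i] by rewrite pnatr_eq0 -lt0n (leq_trans _ M3).
split; [exact: Delta_varsigma1 | exact: Delta_varsigma2].
Qed.
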